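(* For any pair of compositions $\alpha$ and $\beta$, $$\pi(X_\alpha\#X_\beta)=h_{\widetilde\alpha}\#h_{\widetilde\beta}.$$
   Context: Let $\Bbbk$ be a field of characteristic zero. For a composition $\alpha$, $\widetilde\alpha$ denotes the partition obtained by reordering its parts. $\Sigma=\bigoplus_n\Sigma_n$, where $\Sigma_n\subseteq\Bbbk S_n$ has basis $X_\alpha=\sum_{\mathrm{Des}(\sigma)\subseteq\{a_1,a_1+a_2,\dots,a_1+\cdots+a_{r-1}\}}\sigma$, for $\alpha=(a_1,\dots,a_r)$ a composition of $n$, with $\mathrm{Des}(\sigma)=\{i:\sigma(i)>\sigma(i+1)\}$. $\Lambda=\bigoplus_n\Lambda_n$ is the space of symmetric functions over $\Bbbk$, with basis $h_\lambda=h_{\lambda_1}h_{\lambda_2}\cdots$ of complete homogeneous symmetric functions. The linear map $\pi:\Sigma\to\Lambda$ is defined by $\pi(X_\alpha)=h_{\widetilde\alpha}$. For compositions $\alpha=(a_1,\dots,a_r)$ of $p$, $\beta=(b_1,\dots,b_s)$ of $q$ and $\max(p,q)\le n\le p+q$, $\mathcal M^n_{\alpha,\beta}$ is the set of matrices $M=(m_{ij})_{0\le i\le s,\,0\le j\le r}$ of non-negative integers with $m_{00}=0$, column sums $(n-p,a_1,\dots,a_r)$ and row sums $(n-q,b_1,\dots,b_s)$; $c(M)$ is the composition of non-zero entries of $M$ read left to right, top to bottom, and $p(M)$ the partition formed by the non-zero entries. The Heisenberg product on $\Sigma$ is (the restriction of the Heisenberg product of permutations, and is) given explicitly by $X_\alpha\#X_\beta=\sum_{n=\max(p,q)}^{p+q}\sum_{M\in\mathcal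 M^n_{\alpha,\beta}}X_{c(M)}$. The Heisenberg product on $\Lambda$ is (induced from representations of symmetric groups through the Frobenius characteristic, and is) given explicitly by $h_\alpha\#h_\beta=\sum_{n=\max(p,q)}^{p+q}\sum_{M\in\mathcal M^n_{\alpha,\beta}}h_{p(M)}$ for partitions $\alpha$ of $p$ and $\beta$ of $q$. *)

(* Defs.v *)
From HB Require Import structures.
From mathcomp Require Import all_boot all_order all_algebra perm.
From mathcomp Require Import freeg mpoly.
From mathcomp Require Import boolp.

Set Implicit Arguments.
Unset Strict Implicit.
Unset Printing Implicit Defensive.

Import GRing.Theory.
Local Open Scope ring_scope.

Record composition := Composition {
  composition_parts :> seq nat;
  _ : 0%N \notin composition_parts
}.
HB.instance Definition _ := [isSub for composition_parts].
HB.instance Definition _ := [Choice of composition by <:].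

Record int_partition := IntPartition {
  partition_parts :> seq nat;
  _ : (0%N \notin partition_parts) && sorted geq partition_parts
}.
HB.instance Definition _ := [isSub for partition_parts].
HB.instance Definition _ := [Choice of int_partition by <:].

Lemma nonzero_notin0 (s : seq nat) : 0%N \notin [seq x <- s | x != 0%N].
Proof. by rewrite mem_filter. Qed.

Lemma sort_geq_partition (s : seq nat) :
  (0%N \notin s) -> (0%N \notin sort geq s) && sorted geq (sort geq s).
Proof.
by move=> s0; rewrite mem_sort s0 sort_sorted // => m n; apply: leq_total.
Qed.

Definition composition_of (s : seq nat) : composition :=
  Composition (nonzero_notin0 s).

Definition partition_of (s : seq nat) : int_partition :=
  IntPartition (sort_geq_partition (nonzero_notin0 s)).

(* The entries of a matrix in M^n_{a,b} are bounded by its column sums, hence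
   by n; taking them in 'I_n.+1 makes the index set finite.  Rows are indexed
   by 0, ..., size b and columns by 0, ..., size a. *)
Definition heis_mx (n : nat) (a b : seq nat) :
    {set 'M['I_n.+1]_((size b).+1, (size a).+1)} :=
  [set M : 'M['I_n.+1]_((size b).+1, (size a).+1) |
    [&& M ord0 ord0 == ord0,
      [forall j, (\sum_i val (M i j))%N
                   == nth 0%N ((n - sumn a)%N :: a) j] &
      [forall i, (\sum_j val (M i j))%N
                   == nth 0%N ((n - sumn b)%N :: b) i]]].

Definition mx_entries (n p q : nat) (M : 'M['I_n.+1]_(p, q)) : seq nat :=
  [seq val (M i j) | i <- enum 'I_p, j <- enum 'I_q].

Definition mx_comp (n p q : nat) (M : 'M['I_n.+1]_(p, q)) : composition :=
  composition_of (mx_entries M).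

Definition mx_part (n p q : nat) (M : 'M['I_n.+1]_(p, q)) : int_partition :=
  partition_of (mx_entries M).

Section LinearCombination.
Variables (k : fieldType) (I : choiceType) (V : lmodType k) (B : I -> V).

HB.instance Definition _ :=
  GRing.isZmodMorphism.Build {freeg I / k} V (fglift B) (lift_is_additive B).

Lemma fglift_scalable : scalable (fglift B).
Proof.
move=> c D; rewrite -[in RHS](freeg_sumE D) !raddf_sum /=.
by apply: eq_bigr => i _; rewrite /= !liftU scalerA.
Qed.
HB.instance Definition _ :=
  GRing.isScalable.Build k {freeg I / k} V *:%R (fglift B) fglift_scalable.

End LinearCombination.

Section LinearExtension.
Variables (k : fieldType) (I : choiceType) (V : lmodType k) (B : I -> V).

(* {freeg I / k} is the space of finitely supported families of scalars, and
   fglift B c is the linear combination of the B i with coefficients c.  When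
   B is a basis of V, coords v is the family of coordinates of v in B;
   it is 0, by convention, for v outside the span of B. *)
Definition coords (v : V) : {freeg I / k} :=
  if pselect (exists c, fglift B c = v) is left e then sval (cid e) else 0.

(* For a basis B, the linear map sending each B i to w i. *)
Definition linear_ext (W : lmodType k) (w : I -> W) (v : V) : W :=
  fglift w (coords v).

(* For a basis B, the bilinear map sending each (B i, B j) to op i j. *)
Definition bilinear_ext (op : I -> I -> V) (u v : V) : V :=
  linear_ext (fun i => linear_ext (op i) v) u.

End LinearExtension.

Section DescentAlgebra.
Variable k : fieldType.

(* An element d of Des s is the descent position d (counted from 1), that is
   s(d) > s(d + 1) when positions are counted from 1; the positions of 'I_n
   are counted from 0, so that this reads s (d - 1) > s d. *)
Definition Des (n : nat) (s : 'S_n) : {set 'I_n} :=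
  [set d : 'I_n |
    [exists i : 'I_n, (i.+1 == d :> nat) && (s d < s i)%N]].

Definition partial_sums (a : seq nat) : seq nat :=
  [seq sumn (take i a) | i <- iota 1 (size a).-1].

(* The direct sum over n of the spaces k S_n. *)
Definition perm_space := {freeg {n : nat & 'S_n} / k}.

Definition X_perm (a : composition) : perm_space :=
  \sum_(s : 'S_(sumn a) | [forall d in Des s, val d \in partial_sums a])
     << Tagged (fun n => 'S_n) s >>.

Definition in_Sigma : pred perm_space :=
  fun x => `[< exists c, fglift X_perm c = x >].

Lemma in_Sigma_submod : submod_closed in_Sigma.
Proof.
split=> [|c x y /asboolP [cx <-] /asboolP [cy <-]]; apply/asboolP.
  by exists 0; rewrite raddf0.
by exists (c *: cx + cy); rewrite linearP.
Qed.
HB.instance Definition _ := GRing.isSubmodClosed.Build k perm_space in_Sigma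
  in_Sigma_submod.

Record Sigma := MkSigma {
  Sigma_val :> perm_space;
  _ : in_Sigma Sigma_val
}.
HB.instance Definition _ := [isSub for Sigma_val].
HB.instance Definition _ := [Choice of Sigma by <:].
HB.instance Definition _ := [SubChoice_isSubLmodule of Sigma by <:].

Lemma X_in_Sigma (a : composition) : in_Sigma (X_perm a).
Proof. by apply/asboolP; exists << a >>; rewrite liftU scale1r. Qed.

Definition X (a : composition) : Sigma := MkSigma (X_in_Sigma a).

Definition heis_X (a b : composition) : Sigma :=
  \sum_(maxn (sumn a) (sumn b) <= n < (sumn a + sumn b).+1)
    \sum_(M in heis_mx n a b) X (mx_comp M).

Definition heis_Sigma : Sigma -> Sigma -> Sigma := bilinear_ext X heis_X.

End DescentAlgebra.

Section SymmetricFunctions.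
Variable k : fieldType.

(* Symmetric functions as compatible families f = (f_n)_n of symmetric
   polynomials f_n in n variables, of bounded degree: the value of f_n.+1 when
   its last variable is set to 0 is f_n. *)
Definition mpoly_family := forall n, {mpoly k[n]}.

HB.instance Definition _ := gen_eqMixin mpoly_family.
HB.instance Definition _ := gen_choiceMixin mpoly_family.

Let fam0 : mpoly_family := fun=> 0.
Let famN (f : mpoly_family) : mpoly_family := fun n => - f n.
Let famD (f g : mpoly_family) : mpoly_family := fun n => f n + g n.
Let famZ (c : k) (f : mpoly_family) : mpoly_family := fun n => c *: f n.

Fact famDA : associative famD.
Proof. by move=> f g h; apply: functional_extensionality_dep => n; apply: addrA. Qed.
Fact famDC : commutative famD.
Proof. by move=> f g; apply: functional_extensionality_dep => n; apply: addrC. Qed.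
Fact fam0D : left_id fam0 famD.
Proof. by move=> f; apply: functional_extensionality_dep => n; apply: add0r. Qed.
Fact famND : left_inverse fam0 famN famD.
Proof. by move=> f; apply: functional_extensionality_dep => n; apply: addNr. Qed.
HB.instance Definition _ :=
  GRing.isZmodule.Build mpoly_family famDA famDC fam0D famND.

Fact famZA c d f : famZ c (famZ d f) = famZ (c * d) f.
Proof. by apply: functional_extensionality_dep => n; apply: scalerA. Qed.
Fact fam1Z : left_id 1 famZ.
Proof. by move=> f; apply: functional_extensionality_dep => n; apply: scale1r. Qed.
Fact famZDr : right_distributive famZ +%R.
Proof.
by move=> c f g; apply: functional_extensionality_dep => n; apply: scalerDr.
Qed.
Fact famZDl f : {morph famZ^~ f : c d / c + d}.
Proof. by move=> c d; apply: functional_extensionality_dep => n; apply: scalerDl. Qed.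
HB.instance Definition _ :=
  GRing.Zmodule_isLmodule.Build k mpoly_family famZA fam1Z famZDr famZDl.

Definition last_var0 (n : nat) (p : {mpoly k[n.+1]}) : {mpoly k[n]} :=
  p \mPo [tuple oapp (fun j : 'I_n => 'X_j) 0 (unlift ord_max i) | i < n.+1].

Definition in_Lambda : pred mpoly_family := fun f =>
  `[< [/\ forall n, f n \is symmetric,
          forall n, last_var0 (f n.+1) = f n &
          exists d, forall n, (msize (f n) <= d)%N] >].

Lemma in_Lambda_submod : submod_closed in_Lambda.
Proof.
split=> [|c f g /asboolP [fs fr [d fd]] /asboolP [gs gr [e ge]]]; apply/asboolP.
  split=> [n|n|]; first exact: rpred0.
    by rewrite /last_var0 comp_mpoly0.
  by exists 0%N => n; rewrite msize0.
have famE n : (c *: f + g) n = c *: f n + g n by [].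
split=> [n|n|].
- rewrite famE; apply: rpredD; last exact: gs.
  by apply: rpredZ; exact: fs.
- by rewrite !famE -(fr n) -(gr n) /last_var0 comp_mpolyD comp_mpolyZ.
- exists (maxn d e) => n; rewrite famE; apply: leq_trans (msizeD_le _ _) _.
  by rewrite geq_max !leq_max ge orbT andbT (leq_trans (msizeZ_le _ _)) ?fd.
Qed.
HB.instance Definition _ := GRing.isSubmodClosed.Build k mpoly_family in_Lambda
  in_Lambda_submod.

Record Lambda := MkLambda {
  Lambda_val :> mpoly_family;
  _ : in_Lambda Lambda_val
}.
HB.instance Definition _ := [isSub for Lambda_val].
HB.instance Definition _ := [Choice of Lambda by <:].
HB.instance Definition _ := [SubChoice_isSubLmodule of Lambda by <:].

Definition hsym (d n : nat) : {mpoly k[n]} :=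
  \sum_(m : 'X_{1..n < d.+1} | mdeg m == d) 'X_[m].

Definition h_family (l : int_partition) : mpoly_family :=
  fun n => \prod_(d <- l) hsym d n.

Lemma hsymE d n (m : 'X_{1..n}) : (hsym d n)@_m = (mdeg m == d)%:R.
Proof.
rewrite raddf_sum /=; under eq_bigr do rewrite mcoeffX.
have [md|md] := eqVneq (mdeg m) d; last first.
  by apply: big1 => m' /eqP m'd; case: eqP => // mm'; rewrite -mm' m'd eqxx in md.
have lt_md : (mdeg m < d.+1)%N by rewrite md.
rewrite (bigD1 (BMultinom lt_md)) ?md //= eqxx big1 ?addr0 // => m' /andP[_ m'N].
by case: eqP => // mm'; case/negP: m'N; apply/eqP/val_inj.
Qed.

Lemma hsym_sym d n : hsym d n \is symmetric.
Proof.
apply/issymP=> s; apply/mpolyP=> m.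
by rewrite mcoeff_sym !hsymE mdeg_mperm.
Qed.

Lemma hsym_last_var0 d n : last_var0 (hsym d n.+1) = hsym d n.
Proof.
apply/mpolyP => m; rewrite hsymE /last_var0 /hsym; set t := mktuple _.
rewrite [_ \mPo _]raddf_sum raddf_sum /=.
have t_widen (i : 'I_n) : tnth t (widen_ord (leqnSn n) i) = 'X_i.
  rewrite tnth_mktuple.
  suff -> : widen_ord (leqnSn n) i = fintype.lift ord_max i by rewrite liftK.
  by apply/val_inj; rewrite /= /bump leqNgt ltn_ord.
have t_max : tnth t ord_max = 0 by rewrite tnth_mktuple unlift_none.
have XE (m' : 'X_{1..n.+1}) : ('X_[m'] \mPo t)@_m = (m' == mnmwiden m)%:R.
  rewrite comp_mpolyX big_ord_recr /= t_max.
  under eq_bigr do rewrite t_widen.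
  have [m'0|m'N0] := posnP (m' ord_max); last first.
    rewrite expr0n eqn0Ngt m'N0 /= mulr0 mcoeff0; case: eqP => // m'E.
    by rewrite m'E mnmwiden_ordmax in m'N0.
  rewrite m'0 expr0 mulr1.
  pose m1 := [multinom m' (widen_ord (leqnSn n) i) | i < n].
  have -> : \prod_(i < n) 'X_i ^+ m' (widen_ord (leqnSn n) i)
            = 'X_[m1] :> {mpoly k[n]}.
    by rewrite mpolyXE_id; apply: eq_bigr => i _; rewrite mnmE.
  have <- : mnmwiden m1 = m'.
    apply/mnmP => i; case: (unliftP ord_max i) => [j|] -> .
      have -> : fintype.lift ord_max j = widen_ord (leqnSn n) j.
        by apply/val_inj; rewrite /= /bump leqNgt ltn_ord.
      by rewrite mnmwiden_widen mnmE.
    by rewrite mnmwiden_ordmax m'0.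
  by rewrite mcoeffX (inj_eq (@inj_mnmwiden n)).
under eq_bigr do rewrite XE.
have := hsymE d (mnmwiden m); rewrite raddf_sum /=.
under eq_bigr do rewrite mcoeffX.
move->; congr (_ == _)%:R.
by rewrite !mdegE big_ord_recr /= mnmwiden_ordmax addn0;
  apply: eq_bigr => i _; rewrite mnmwiden_widen.
Qed.

Lemma h_in_Lambda (l : int_partition) : in_Lambda (h_family l).
Proof.
apply/asboolP; split=> [n|n|].
- by apply: rpred_prod => d _; apply: hsym_sym.
- rewrite /last_var0 /h_family rmorph_prod; apply: eq_bigr => d _.
  exact: hsym_last_var0.
- exists (sumn l).+1 => n; rewrite /h_family.
  elim: (l : seq nat) => [|d s IHs] /=; first by rewrite big_nil msize1.
  rewrite big_cons; have [-> | hd0] := eqVneq (hsym d n) 0.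
    by rewrite mul0r msize0.
  set p := \prod_(_ <- _) _ in IHs *.
  have [-> | p0] := eqVneq p 0; first by rewrite mulr0 msize0.
  have hd : (msize (hsym d n) <= d.+1)%N.
    rewrite msizeE; apply/bigmax_leqP_seq => m + _.
    by rewrite mcoeff_msupp hsymE; case: (eqVneq (mdeg m) d) => [->|_] //; rewrite eqxx.
  rewrite msizeM // -subn1 leq_subLR.
  by apply: leq_trans (leq_add hd IHs) _; rewrite !addSn addnS.
Qed.

Definition h (l : int_partition) : Lambda := MkLambda (h_in_Lambda l).

Definition heis_h (a b : int_partition) : Lambda :=
  \sum_(maxn (sumn a) (sumn b) <= n < (sumn a + sumn b).+1)
    \sum_(M in heis_mx n a b) h (mx_part M).

Definition heis_Lambda : Lambda -> Lambda -> Lambda := bilinear_ext h heis_h.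

Definition pi_Lambda : Sigma k -> Lambda :=
  linear_ext (@X k) (fun a => h (partition_of a)).

End SymmetricFunctions.

(* Main.v *)
(* Once the X_a and the h_l are known to be linearly independent, the two
   products are given by their explicit formulas, and a bijection between the
   index matrices for (a, b) and for their sorted versions is obtained by
   permuting columns and rows, which preserves the multiset of entries.

   Independence of the X_a: a permutation whose descent set is exactly the set
   of partial sums of a occurs in X_b only if b is a or strictly refines a.

   Independence of the h_l: the elementary symmetric polynomials e_1, ..., e_n
   are algebraically independent.  The relations
   sum_i (-1)^i e_i h_(d-i) = 0 are symmetric in e and h, so the substitution
   Theta of generators that expresses the h_d through the e_d is an involution,
   hence h_1, ..., h_n are algebraically independent as well. *)
Require Import Defs.
From mathcomp Require Import all_boot all_order all_algebra.
From mathcomp Require Import perm freeg mpoly boolp zify.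

Set Implicit Arguments.
Unset Strict Implicit.
Unset Printing Implicit Defensive.

Import GRing.Theory.
Local Open Scope ring_scope.

(** * Linear and bilinear extension along an independent family *)

Section FreeFamilies.
Variables (k : fieldType) (I : choiceType).

Lemma fglift_sum (V : lmodType k) (B : I -> V) (c : {freeg I / k}) :
  fglift B c = \sum_(i <- dom c) coeff i c *: B i.
Proof.
rewrite -[in LHS](freeg_sumE c) raddf_sum.
by apply: eq_bigr => i _; rewrite /= liftU.
Qed.

Definition lin_indep (V : lmodType k) (B : I -> V) :=
  forall c, fglift B c = 0 -> c = 0.

Variables (V W : lmodType k) (B : I -> V) (w : I -> W).
Hypothesis B_free : lin_indep B.

(** [coords] picks some preimage under [fglift B] by choice; independence makes it the only one. *)
Lemma fgliftK : cancel (fglift B) (coords B).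
Proof.
move=> c; rewrite /coords; case: pselect => [e|[]]; last by exists c.
case: (cid e) => c' /= c'E; apply/eqP; rewrite -subr_eq0; apply/eqP/B_free.
by rewrite raddfB /= c'E subrr.
Qed.

Lemma linear_ext_fglift c : linear_ext B w (fglift B c) = fglift w c.
Proof. by rewrite /linear_ext fgliftK. Qed.

(** Each [B i] is the image of [<< i >>] under [fglift B]. This identifies the Heisenberg products
    of basis elements with [heis_X] and [heis_h]. *)
Lemma bilinear_ext_base (op : I -> I -> V) i j :
  bilinear_ext B op (B i) (B j) = op i j.
Proof.
by rewrite /bilinear_ext -[B i]scale1r -liftU /linear_ext !fgliftK
  liftU scale1r -[B j]scale1r -liftU fgliftK liftU scale1r.
Qed.

End FreeFamilies.

(** * Permutations with a prescribed descent set *)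

Lemma perm_with_descents (n : nat) (D : pred nat) :
  exists s : 'S_n, forall d : 'I_n, (d \in Des s) = (0 < d)%N && D d.
Proof.
(* s ranks the positions by decreasing block, then by increasing position. *)
pose blk i := count D (iota 0 i.+1).
pose prec (j i : 'I_n) :=
  (blk i < blk j)%N || ((blk j == blk i) && (j < i)%N).
have prec_irr i : prec i i = false by rewrite /prec !ltnn andbF.
have prec_trans : transitive prec by rewrite /prec => j i l; lia.
pose below i := [set j | prec j i].
have belowP i j : prec i j -> (#|below i| < #|below j|)%N.
  move=> ij; apply/proper_card/properP; split.
    by apply/subsetP => l; rewrite !inE => /prec_trans; apply.
  by exists i; rewrite !inE ?prec_irr.
have rank_lt i : (#|below i| < n)%N.
  rewrite -[n in (_ < n)%N]card_ord -cardsT; apply/proper_card/properP.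
  by split; [exact: subsetT | exists i; rewrite !inE ?prec_irr].
pose rank i := Ordinal (rank_lt i).
have rank_inj : injective rank.
  move=> i j /(congr1 val) /= ij; apply/val_inj/eqP; apply: contraT => neq.
  have /orP[] : prec i j || prec j i by move: neq; rewrite /prec /=; lia.
    by move=> /belowP; rewrite ij ltnn.
  by move=> /belowP; rewrite ij ltnn.
exists (perm rank_inj) => d; rewrite inE.
have rankE i j : (rank i < rank j)%N = prec i j.
  apply/idP/idP=> [|/belowP //]; apply: contraLR.
  have [-> //|ij] := eqVneq i j; first by rewrite ltnn.
  have: prec i j || prec j i by rewrite /prec; move: ij; rewrite -val_eqE /=; lia.
  by case: (prec i j) => //= /belowP ji _; rewrite -leqNgt ltnW.
(* The block number rises between adjacent positions exactly when [D] holds at the second one. A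
   higher block has lower ranks, so this is where the descents are; inside a block ranks
   increase. *)
have blkS i : blk i.+1 = (blk i + D i.+1)%N.
  by rewrite /blk -[in LHS]addn1 iotaD count_cat /= add0n addn0.
apply/existsP/andP => [[i]|[d0 Dd]].
  rewrite !permE rankE /prec => /andP[/eqP <-].
  by rewrite blkS; case: (D _) => //; lia.
have lt_d : (d.-1 < n)%N by have := ltn_ord d; lia.
exists (Ordinal lt_d); rewrite !permE rankE /= prednK // eqxx /prec /=.
by rewrite -[in blk d](prednK d0) blkS prednK // Dd; lia.
Qed.

(** * Compositions and their partial sums *)

Section PartialSums.
Local Open Scope nat_scope.
Implicit Types (a b : seq nat) (x y : nat).

Lemma partial_sums_cons x y a :
  partial_sums (x :: y :: a) = x :: [seq x + z | z <- partial_sums (y :: a)].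
Proof.
rewrite /partial_sums /= addn0; congr (_ :: _).
by rewrite -map_comp -[2]addn1 iotaDl -map_comp; apply: eq_map.
Qed.

Lemma size_partial_sums a : size (partial_sums a) = (size a).-1.
Proof. by rewrite size_map size_iota. Qed.

Lemma partial_sums_path a : 0 \notin a -> path ltn 0 (partial_sums a).
Proof.
elim: a => // x [//|y a] IHa; rewrite inE negb_or eq_sym -lt0n => /andP[x0 /IHa].
rewrite partial_sums_cons /= x0 /=.
move=> IH; rewrite -[x in path _ x]addn0 (mono_path (e := ltn)); first exact: IH.
by move=> u v; apply: ltn_add2l.
Qed.

Lemma mem_partial_sums a d :
  0 \notin a -> d \in partial_sums a -> 0 < d < sumn a.
Proof.
move=> a0 da; apply/andP; split.
  by have /(order_path_min ltn_trans)/allP/(_ d da) := partial_sums_path a0.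
elim: a a0 d da => // x [//|y a] IHa.
rewrite inE negb_or => /andP[x0 /[dup] a0 /IHa {}IHa] d.
rewrite partial_sums_cons inE => /predU1P[->|/mapP[z /IHa za ->]].
  by move: a0; rewrite inE negb_or /=; lia.
by move: za => /=; lia.
Qed.

Lemma size_le_sumn a : 0 \notin a -> size a <= sumn a.
Proof.
by elim: a => //= x a IHa; rewrite inE negb_or => /andP[x0 /IHa]; lia.
Qed.

(** [partial_sums] omits the full sum, so the last part is recovered from [sumn a = sumn b]. *)
Lemma partial_sums_inj a b : 0 \notin a -> 0 \notin b -> sumn a = sumn b ->
  partial_sums a = partial_sums b -> a = b.
Proof.
move=> a0 b0 ab pab; have szab : (size a).-1 = (size b).-1.
  by rewrite -!size_partial_sums pab.
elim: a b a0 b0 ab pab szab => [|x [|y a] IHa] [|x' [|y' b]] //=.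
- by rewrite !inE; lia.
- by rewrite !inE; lia.
- by move=> _ _; rewrite !addn0 => ->.
move=> a0 b0 ab; rewrite !partial_sums_cons => -[xx'].
rewrite xx' => /(inj_map (@addnI x')) pab szab.
congr (_ :: _); apply: IHa => //; last by move: szab => /= [->].
- by move: a0; rewrite inE negb_or => /andP[].
- by move: b0; rewrite inE negb_or => /andP[].
by move: ab => /=; rewrite xx'; lia.
Qed.

(** Partial sums are strictly increasing, so an inclusion into a list that is no longer is an
    equality: a refinement without additional parts is trivial. *)
Lemma partial_sums_sub a b : 0 \notin a -> 0 \notin b -> sumn a = sumn b ->
  {subset partial_sums a <= partial_sums b} -> size b <= size a -> a = b.
Proof.
move=> a0 b0 ab sub szba; apply: partial_sums_inj => //.
have pa := path_sorted (partial_sums_path a0).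
have pb := path_sorted (partial_sums_path b0).
apply: (irr_sorted_eq ltn_trans ltnn) => //.
have ua := sorted_uniq ltn_trans ltnn pa.
have sz : size (partial_sums b) <= size (partial_sums a).
  by rewrite !size_partial_sums; lia.
by case: (uniq_min_size ua sub sz).
Qed.

End PartialSums.

(** * Linear independence of the [X a] *)

Section IndependenceX.
Variable k : fieldType.

Lemma coeff_X_perm n (s : 'S_n) (a : composition) :
  coeff (Tagged (fun n => 'S_n) s) (X_perm k a) =
  ((sumn a == n) && [forall d in Des s, val d \in partial_sums a])%:R.
Proof.
rewrite raddf_sum /=; under eq_bigr do rewrite coeffU mul1r.
have [En|neq_n] := eqVneq (sumn a) n; last first.
  apply: big1 => s' _; case: eqP => // /(congr1 tag) /= En.
  by rewrite En eqxx in neq_n.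
case: _ / En s => s /=.
under eq_bigr do rewrite eq_Tagged.
case: (boolP [forall d in Des s, _]) => [sa|/negPf sa].
  by rewrite (bigD1 s) //= eqxx big1 ?addr0 // => s' /andP[_ /negPf /= ->].
by apply: big1 => s' s'a; case: (eqVneq s' s) s'a => [->|_] //; rewrite sa.
Qed.

Lemma X_perm_indep : lin_indep (X_perm k).
Proof.
move=> c c0; apply/eqP/freeg_eqP => a; rewrite coeff0.
have nz (b : composition) : 0%N \notin (b : seq nat) by case: b.
(* Compositions with more parts come first: when [a] is reached, the coefficients of its strict
   refinements are known to vanish, so [s] isolates the coefficient of [a]. *)
have [m] := ubnP (sumn a - size a); elim: m => // m IHm in a *.
move=> lt_m; have [s sE] := perm_with_descents (sumn a) (mem (partial_sums a)).
have := congr1 (coeff (Tagged (fun n => 'S_n) s)) c0.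
have coeff_s (b : composition) : coeff b c != 0 ->
    coeff (Tagged (fun n => 'S_n) s) (X_perm k b) = (b == a)%:R.
  move=> cb; rewrite coeff_X_perm; congr (nat_of_bool _)%:R.
  apply/idP/eqP => [/andP[/eqP sumab /'forall_implyP sb]|->]; last first.
    rewrite eqxx; apply/'forall_implyP => d; rewrite sE.
    by case/andP.
  have sub : {subset partial_sums a <= partial_sums b}.
    move=> d da; have /andP[d0 ltd] := mem_partial_sums (nz a) da.
    by apply: (sb (Ordinal ltd)); rewrite sE d0.
  apply/val_inj/esym; apply: partial_sums_sub => //; rewrite leqNgt.
  apply: contra cb => ltab; apply/eqP/IHm.
  by have := size_le_sumn (nz b); move: ltab => /=; lia.
rewrite coeff0 fglift_sum raddf_sum /=.
under eq_big_seq => b.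
  by rewrite mem_dom => /coeff_s cb; rewrite coeffZ cb; over.
have [a_dom|/coeff_outdom -> //] := boolP (a \in dom c).
rewrite (bigD1_seq a) ?uniq_dom //= eqxx mulr1 big1 ?addr0 // => b /negPf ->.
by rewrite mulr0.
Qed.

Lemma X_indep : lin_indep (@X k).
Proof.
move=> c c0; apply: X_perm_indep; move/(congr1 val): c0.
by rewrite !fglift_sum raddf_sum.
Qed.

End IndependenceX.

(** * Permuting rows and columns of the index matrices *)

(** Index 0 is the additional row or column, with its own sum [x]. It stays in place, so that the
    corner entry required to be zero does too. The ordinal types differ because the two sizes are
    only provably equal. *)
Lemma perm_eq_reindex (s t : seq nat) : perm_eq s t ->
  exists f : 'I_(size t).+1 -> 'I_(size s).+1,
    [/\ bijective f, f ord0 = ord0 &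
        forall x i, nth 0%N (x :: s) (f i) = nth 0%N (x :: t) i].
Proof.
rewrite perm_sym => /[dup] /perm_size szts /(perm_iotaP 0%N)[Is Is_perm tE].
pose L := 0%N :: map S Is.
have L_perm : perm_eq L (iota 0 (size s).+1).
  by rewrite /L /= perm_cons (iotaDl 1 0) perm_map.
have szL : size L = (size s).+1 by rewrite (perm_size L_perm) size_iota.
have ltL i : (i < (size s).+1)%N -> (nth 0%N L i < (size s).+1)%N.
  rewrite -[X in (i < X)%N]szL => /(mem_nth 0%N).
  by rewrite (perm_mem L_perm) mem_iota.
pose f (i : 'I_(size t).+1) : 'I_(size s).+1 := inord (nth 0%N L i).
have fE i : f i = nth 0%N L i :> nat by rewrite inordK ?ltL // -szts.
exists f; split; last 1 first.
- move=> x i; rewrite fE; case: i => -[|i] //= lti.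
  have ltI : (i < size Is)%N by rewrite (perm_size Is_perm) size_iota -szts.
  by rewrite (nth_map 0%N) //= tE (nth_map 0%N).
- apply: inj_card_bij; last by rewrite !card_ord szts.
  move=> i j /(congr1 (@nat_of_ord _)); rewrite !fE => /eqP.
  rewrite nth_uniq ?szL -?szts // => [/eqP/val_inj //|].
  by rewrite (perm_uniq L_perm) iota_uniq.
- by apply/val_inj; rewrite /= fE.
Qed.

Lemma mx_part_mxsub (n p q p' q' : nat) (f : 'I_p' -> 'I_p) (g : 'I_q' -> 'I_q)
    (M : 'M['I_n.+1]_(p, q)) : bijective f -> bijective g ->
  mx_part (mxsub f g M) = mx_part M.
Proof.
move=> f_bij g_bij; apply/val_inj => /=; apply/perm_sortP.
- by move=> x y; apply: leq_total.
- by move=> x y z /= ? ?; lia.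
- by move=> x y /= ?; lia.
apply: perm_filter; rewrite /mx_entries.
have -> : [seq val (mxsub f g M i j) | i <- enum 'I_p', j <- enum 'I_q'] =
  [seq val (M i j) | i <- map f (enum 'I_p'), j <- map g (enum 'I_q')].
  rewrite allpairs_mapl allpairs_mapr; congr flatten.
  by apply: eq_map => i; apply: eq_map => j; rewrite mxE.
have enum_bij m m' (u : 'I_m' -> 'I_m) : bijective u ->
    perm_eq (map u (enum 'I_m')) (enum 'I_m).
  move=> u_bij; apply: uniq_perm; rewrite ?enum_uniq //.
    by rewrite map_inj_uniq ?enum_uniq //; apply: bij_inj.
  case: u_bij => v uK vK i; rewrite mem_enum; apply/mapP.
  by exists (v i); rewrite ?mem_enum.
by apply: perm_allpairs; apply: enum_bij.
Qed.

Lemma heis_sum_perm (V : nmodType) (F : int_partition -> V) (n : nat)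
    (a b a' b' : seq nat) : perm_eq a a' -> perm_eq b b' ->
  \sum_(M in heis_mx n a b) F (mx_part M) =
  \sum_(M in heis_mx n a' b') F (mx_part M).
Proof.
move=> aa' bb'; have [g [g_bij g0 gE]] := perm_eq_reindex aa'.
have [f [f_bij f0 fE]] := perm_eq_reindex bb'.
have suma : sumn a = sumn a' by apply: perm_sumn.
have sumb : sumn b = sumn b' by apply: perm_sumn.
case: (f_bij) => f' fK f'K; case: (g_bij) => g' gK g'K.
rewrite [RHS](reindex (fun M => mxsub f g M)) /=; last first.
  exists (fun M => mxsub f' g' M) => M _; apply/matrixP=> i j; rewrite !mxE.
    by rewrite f'K g'K.
  by rewrite fK gK.
apply: eq_big => M; last by rewrite mx_part_mxsub.
have reind (I J : finType) (u : I -> J) (P : pred J) : bijective u ->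
    [forall j, P j] = [forall i, P (u i)].
  case=> v uK vK; apply/forallP/forallP => Pu x; first exact: Pu.
  by rewrite -(vK x).
rewrite !inE mxE f0 g0 -suma -sumb; congr [&& _, _ & _].
  rewrite (reind _ _ g) //; apply: eq_forallb => j; rewrite gE.
  rewrite [in LHS](reindex f) /=; last exact: onW_bij.
  by congr (_ == _); apply: eq_bigr => i _; rewrite mxE.
rewrite (reind _ _ f) //; apply: eq_forallb => i; rewrite fE.
rewrite [in LHS](reindex g) /=; last exact: onW_bij.
  by congr (_ == _); apply: eq_bigr => j _; rewrite mxE.
Qed.

(** * Dual sequences, modelled on the relations between e and h *)

Section DualSequence.
Variable R : comNzRingType.
Implicit Types (a b : nat -> R).

(** The coefficient of [t^d] in [A(-t) B(t)], for the generating series [A] of [a] and [B] of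
    [b]. *)
Definition dual_rel a b d := \sum_(i < d.+1) (-1) ^+ i * a i * b (d - i)%N.

(** Replacing [t] by [-t] exchanges the two series and multiplies the coefficient by [(-1)^d]; here
    the sum is reversed. *)
Lemma dual_rel_sym a b d : dual_rel a b d = (-1) ^+ d * dual_rel b a d.
Proof.
rewrite /dual_rel mulr_sumr (reindex_inj rev_ord_inj) /=.
apply: eq_bigr => i _; rewrite subSS subKn -1?ltnS // -!mulrA [a _ * _]mulrC !mulrA.
by congr (_ * _ * _); rewrite -signr_odd oddB -1?ltnS // signr_addb !signr_odd.
Qed.

(** The recurrence uses all earlier values, so the recursion carries the list of the values at
    [0, ..., d]. *)
Fixpoint dual_prefix a d : seq R :=
  if d is d'.+1 then
    let s := dual_prefix a d' in
    rcons s (\sum_(i < d'.+1) (-1) ^+ i * a i.+1 * s`_(d' - i))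
  else [:: 1].

(* The sequence b with b 0 = 1 and dual_rel a b d = 0 for all d > 0; it is the
   sequence of the h_d when a is that of the e_d, and conversely. *)
Definition dual_seq a d := (dual_prefix a d)`_d.

Lemma size_dual_prefix a d : size (dual_prefix a d) = d.+1.
Proof. by elim: d => //= d IHd; rewrite size_rcons IHd. Qed.

Lemma nth_dual_prefix a d i : (i <= d)%N -> (dual_prefix a d)`_i = dual_seq a i.
Proof.
elim: d => [|d IHd]; first by case: i.
rewrite leq_eqVlt => /predU1P[-> //|ltid].
by rewrite /= nth_rcons size_dual_prefix ltid IHd.
Qed.

Lemma dual_seqS a d :
  dual_seq a d.+1 = \sum_(i < d.+1) (-1) ^+ i * a i.+1 * dual_seq a (d - i)%N.
Proof.
rewrite /dual_seq /= nth_rcons size_dual_prefix ltnn eqxx.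
by apply: eq_bigr => i _; rewrite nth_dual_prefix // leq_subr.
Qed.

Lemma dual_relS a b d : a 0%N = 1 -> dual_rel a b d.+1 =
  b d.+1 - \sum_(i < d.+1) (-1) ^+ i * a i.+1 * b (d - i)%N.
Proof.
move=> a0; rewrite /dual_rel big_ord_recl /= a0 !mul1r subn0; congr (_ + _).
rewrite -sumrN; apply: eq_bigr => i _.
by rewrite /bump /= add1n exprS subSS !mulN1r !mulNr.
Qed.

Lemma dual_rel_seq a d : a 0%N = 1 -> dual_rel a (dual_seq a) d.+1 = 0.
Proof. by move=> a0; rewrite dual_relS // dual_seqS subrr. Qed.

Lemma dual_seq_unique a b : a 0%N = 1 -> b 0%N = 1 ->
  (forall d, dual_rel a b d.+1 = 0) -> b =1 dual_seq a.
Proof.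
move=> a0 b0 ab d; have [n] := ubnP d; elim: n => // n IHn in d *.
case: d => // d ltd; move/eqP: (ab d); rewrite dual_relS // subr_eq0 => /eqP ->.
rewrite dual_seqS; apply: eq_bigr => i _.
by rewrite IHn //; lia.
Qed.

(** By [dual_rel_sym], [a] satisfies the relations that characterize the dual of [dual_seq a]. *)
Lemma dual_seqK a : a 0%N = 1 -> dual_seq (dual_seq a) =1 a.
Proof.
move=> a0 d; symmetry; apply: dual_seq_unique => // {}d.
by rewrite dual_rel_sym dual_rel_seq ?mulr0.
Qed.

End DualSequence.

(** The value at [d] is a polynomial in the [a i] with [i <= d]. The bound [n] allows for
    substitutions that are controlled only on n generators. *)
Lemma dual_seq_morph (R S : comNzRingType) (f : {rmorphism R -> S})
    (a : nat -> R) (b : nat -> S) n :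
  (forall i, (i <= n)%N -> f (a i) = b i) ->
  forall d, (d <= n)%N -> f (dual_seq a d) = dual_seq b d.
Proof.
move=> fa d; have [m] := ubnP d; elim: m => // m IHm in d *.
case: d => [|d] ltdm ltdn; first exact: rmorph1.
rewrite !dual_seqS rmorph_sum; apply: eq_bigr => i _.
have lti := ltn_ord i.
by rewrite !rmorphM rmorph_sign fa ?IHm //; lia.
Qed.

Lemma comp_mpoly_comp (R : comNzRingType) (n m l : nat) (p : {mpoly R[n]})
    (s : n.-tuple {mpoly R[m]}) (t : m.-tuple {mpoly R[l]}) :
  (p \mPo s) \mPo t = p \mPo [tuple tnth s i \mPo t | i < n].
Proof.
rewrite [p \mPo s]comp_mpolyEX [RHS]comp_mpolyEX raddf_sum /=.
apply: eq_bigr => u _; rewrite comp_mpolyZ; congr (_ *: _).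
rewrite !comp_mpolyX rmorph_prod; apply: eq_bigr => i _.
by rewrite rmorphXn tnth_mktuple.
Qed.

(** * Algebraic independence of the complete symmetric polynomials *)

Section ElementaryComplete.
Variables (k : fieldType) (n : nat).

Local Notation e := (mesym n k).
Local Notation H := (fun d => hsym k d n).

Lemma mcoeff_mulX_hsym (u m : 'X_{1..n}) d :
  ('X_[u] * H d)@_m = ((u <= m)%MM && (mdeg m == mdeg u + d)%N)%:R.
Proof.
case: (boolP (u <= m)%MM) => [um|u_m] /=.
  rewrite -commr_mpolyX -{1}(submK um) addmC mcoeffMX hsymE.
  by rewrite -{2}(submK um) mdegD addnC eqn_add2l.
rewrite mcoeffM big1 // => -[k1 k2] /= /eqP mE; rewrite mcoeffX.
case: eqP => [uE|_]; last by rewrite mul0r.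
by case/negP: u_m; rewrite mE uE lem_addr.
Qed.

(** Inclusion-exclusion: the coefficient of a monomial of degree [d.+1] is the alternating sum over
    all subsets of its support, which is nonempty. *)
Lemma dual_rel_mesym_hsym d : dual_rel e H d.+1 = 0.
Proof.
apply/mpolyP => m; rewrite mcoeff0.
have -> : dual_rel e H d.+1 = \sum_(S : {set 'I_n} | (#|S| < d.+2)%N)
    (-1) ^+ #|S| * ('X_[mesym1 S] * H (d.+1 - #|S|)%N).
  pose F (S : {set 'I_n}) : 'I_d.+2 := inord #|S|.
  rewrite [RHS](partition_big F xpredT) //=; apply: eq_bigr => i _.
  rewrite mesymE -mulrA mulr_suml mulr_sumr; apply: eq_big => [S|S /eqP -> //].
  apply/eqP/andP => [Si|[ltS /eqP <-]]; last by rewrite inordK.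
  by rewrite Si ltn_ord; split => //; apply/eqP/val_inj; rewrite /= inordK Si.
(* Sets with more than [d.+1] elements can be included: their squarefree monomials divide no
   monomial of degree [d.+1]. *)
transitivity ((mdeg m == d.+1)%:R *
   \sum_(S : {set 'I_n}) (-1) ^+ #|S| * (mesym1 S <= m)%MM%:R : k).
  rewrite raddf_sum /= mulr_sumr big_mkcond /=; apply: eq_bigr => S _.
  have -> : ((-1) ^+ #|S| * ('X_[mesym1 S] * H (d.+1 - #|S|)%N))@_m =
      (-1) ^+ #|S| * ('X_[mesym1 S] * H (d.+1 - #|S|)%N)@_m.
    rewrite -[in LHS]signr_odd -[in RHS]signr_odd !mulr_sign.
    by case: (odd _); rewrite ?mcoeffN.
  rewrite mcoeff_mulX_hsym mdeg_mesym1 mulrCA -natrM mulnb.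
  case: ltnP => ltS; first by rewrite subnKC -1?ltnS // andbC.
  case: eqP => [md|_]; last by rewrite mulr0.
  case: (boolP (_ <= _)%MM) => [/submK mE|_]; last by rewrite mulr0.
  by move: ltS; rewrite -mE in md; rewrite -md mdegD mdeg_mesym1 ltnNge leq_addl.
have [md|_] := eqVneq (mdeg m) d.+1; last by rewrite mul0r.
have [i mi] : exists i, (0 < m i)%N.
  apply/existsP; apply: contraPT md => /existsPn m0; rewrite mdegE big1 // => i _.
  by have := m0 i; lia.
(* The sum over [S] is the expansion of this product, whose factor at a variable occurring in [m] is
   zero. *)
rewrite mul1r; transitivity (\prod_i (- (0 < m i)%N%:R + 1) : k); last first.
  by rewrite (bigD1 i) //= mi addNr mul0r.
rewrite bigA_distr; apply: eq_bigr => S _; rewrite -big_mkcond prodrN -natr_prod.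
congr (_ * _%:R); have [/mnm_lepP Sm|] := boolP (_ <= _)%MM.
  by rewrite big1 // => j jS; have := Sm j; rewrite mnmE jS => ->.
rewrite negb_forall => /existsP[j]; rewrite mnmE.
have [jS|//] := boolP (j \in S); rewrite -ltnNge ltnS leqn0 => /eqP mj.
by rewrite (bigD1 j) //= mj.
Qed.

Lemma hsym0 : H 0%N = 1.
Proof. by apply/mpolyP => m; rewrite hsymE mcoeff1 mdeg_eq0. Qed.

Lemma hsym_dual_mesym : H =1 dual_seq e.
Proof.
apply: dual_seq_unique; [exact: mesym0E | exact: hsym0 |].
exact: dual_rel_mesym_hsym.
Qed.

(** The variables as formal e_1, ..., e_n, with value 1 at index 0 and the default 0 beyond [n].
    [Phi] evaluates them at the actual elementary polynomials. *)
Let ys i : {mpoly k[n]} :=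
  if i is j.+1 then oapp (fun o : 'I_n => 'X_o) 0 (insub j) else 1.
Let Phi := comp_mpoly [tuple e i.+1 | i < n].
Let Theta := comp_mpoly [tuple dual_seq ys i.+1 | i < n].

Let ysS (i : 'I_n) : ys i.+1 = 'X_i.
Proof. by rewrite /ys valK. Qed.

Let Phi_ys i : (i <= n)%N -> Phi (ys i) = e i.
Proof.
case: i => [_|i ltin]; first by rewrite mesym0E /Phi comp_mpoly1.
rewrite (ysS (Ordinal ltin)) /Phi comp_mpolyXU -tnth_nth.
by rewrite tnth_mktuple.
Qed.

Let Theta_ys i : (i <= n)%N -> Theta (ys i) = dual_seq ys i.
Proof.
case: i => [_|i ltin]; first by rewrite /Theta comp_mpoly1.
rewrite (ysS (Ordinal ltin)) /Theta comp_mpolyXU -tnth_nth.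
by rewrite tnth_mktuple.
Qed.

(** Up to index [n], [Theta] commutes with taking duals, so applying it twice dualizes [ys]
    twice. *)
Let ThetaK p : Theta (Theta p) = p.
Proof.
rewrite /Theta comp_mpoly_comp -[RHS]comp_mpoly_id; congr (_ \mPo _).
apply: eq_from_tnth => i; rewrite !tnth_mktuple -/Theta -ysS.
rewrite -[RHS](@dual_seqK _ ys) //.
exact: (dual_seq_morph (f := Theta) Theta_ys (ltn_ord i)).
Qed.

(** This substitution is [Theta] followed by [Phi]; the first is injective by [ThetaK], the second
    by the fundamental theorem of symmetric polynomials. *)
Lemma comp_hsym_eq0 (p : {mpoly k[n]}) :
  p \mPo [tuple H i.+1 | i < n] = 0 -> p = 0.
Proof.
move=> p0; rewrite -(ThetaK p); suff -> : Theta p = 0 by rewrite /Theta comp_mpoly0.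
apply: msym_fundamental_un0; rewrite /Theta comp_mpoly_comp -[RHS]p0.
congr (_ \mPo _); apply: eq_from_tnth => i; rewrite !tnth_mktuple -/Phi.
rewrite hsym_dual_mesym.
exact: (dual_seq_morph (f := Phi) Phi_ys (ltn_ord i)).
Qed.

Definition part_mnm (l : seq nat) : 'X_{1..n} := [multinom count_mem i.+1 l | i < n].

Lemma comp_hsym_part_mnm (l : seq nat) : 0%N \notin l ->
  all (geq n) l -> 'X_[part_mnm l] \mPo [tuple H i.+1 | i < n] = \prod_(d <- l) H d.
Proof.
rewrite comp_mpolyX (eq_bigr (fun i : 'I_n => H i.+1 ^+ count_mem i.+1 l)).
  2: by move=> i _; rewrite tnth_mktuple mnmE.
elim: l => [|d l IHl]; first by rewrite big_nil big1 // => i _; rewrite expr0.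
rewrite inE negb_or eq_sym => /andP[d0 /IHl {}IHl] /andP[dn /IHl {}IHl].
rewrite big_cons -IHl; under eq_bigr do rewrite exprD.
rewrite big_split /=; congr (_ * _).
case: d d0 dn => // d _ ltd; rewrite (bigD1 (Ordinal ltd)) //= eqxx expr1.
rewrite big1 ?mulr1 // => i; rewrite -val_eqE /= => ne.
by rewrite eqSS eq_sym (negPf ne).
Qed.

(** Multiplicities determine a sorted list, and the bound by [n] ensures that [part_mnm] records
    them all. *)
Lemma part_mnm_inj (l l' : int_partition) :
  all (geq n) l -> all (geq n) l' -> part_mnm l = part_mnm l' -> l = l'.
Proof.
have /andP[l0 lS] := valP l; have /andP[l'0 l'S] := valP l'.
move=> ln l'n /mnmP E.
apply/val_inj => /=; apply: (sorted_eq _ _ lS l'S).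
- by move=> x y z /= ? ?; lia.
- by move=> x y /= ?; lia.
apply/allP => x; rewrite mem_cat /= => xl; apply/eqP.
have x0 : (0 < x)%N.
  by rewrite lt0n; apply: contraTneq xl => ->; rewrite negb_or l0.
have xn : (x.-1 < n)%N.
  rewrite prednK //; case/orP: xl => [/(allP ln)|/(allP l'n)] //.
by have := E (Ordinal xn); rewrite !mnmE /= prednK.
Qed.

End ElementaryComplete.

(** * Linear independence of the [h l] *)

Lemma h_indep (k : fieldType) : lin_indep (@h k).
Proof.
move=> c c0; apply/eqP/freeg_eqP => l; rewrite coeff0.
have [l_dom|/coeff_outdom -> //] := boolP (l \in dom c).
(* This [n] bounds every part of every partition in the support of [c], so in [n] variables the
   [h l] are distinct monomials in the independent h_1, ..., h_n. *)
pose n := \sum_(l <- dom c) sumn l.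
have part_le (l' : int_partition) : l' \in dom c -> all (geq n) l'.
  move=> l'c; apply/allP => d dl' /=.
  rewrite /n (bigD1_seq l') ?uniq_dom //=; apply: leq_trans (leq_addr _ _).
  by rewrite (perm_sumn (perm_to_rem dl')) /= leq_addr.
pose p : {mpoly k[n]} := \sum_(l <- dom c) coeff l c *: 'X_[part_mnm n l].
have famE (F : int_partition -> mpoly_family k) (r : seq int_partition) :
  (\sum_(l <- r) coeff l c *: F l) n = \sum_(l <- r) coeff l c *: F l n.
  by elim/big_rec2: _ => // i x y _ <-.
have p0 : p = 0.
  apply: comp_hsym_eq0.
  move/(congr1 (fun f : Lambda k => val f n)): c0.
  have -> : val (fglift (@h k) c) =
      \sum_(l <- dom c) coeff l c *: h_family k l.
    by rewrite fglift_sum raddf_sum.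
  rewrite famE => sum0; apply: (etrans _ sum0).
  rewrite raddf_sum /=; apply: eq_big_seq => l' l'c.
  rewrite comp_mpolyZ; congr (_ *: _).
  rewrite comp_hsym_part_mnm ?part_le //.
  by case: l' {l'c} => /= l' /andP[].
move/(congr1 (mcoeff (part_mnm n l))): p0.
rewrite mcoeff0 raddf_sum /= (bigD1_seq l) ?uniq_dom //= mcoeffZ mcoeffX eqxx mulr1.
rewrite big_seq_cond big1 ?addr0 // => l' /andP[l'c ne].
rewrite mcoeffZ mcoeffX; case: eqP => [/part_mnm_inj l'l|_]; last by rewrite mulr0.
by rewrite l'l ?part_le ?eqxx // in ne.
Qed.

(** * Comparison of the two products *)

Lemma partition_of_composition_of (s : seq nat) :
  partition_of (composition_of s) = partition_of s.
Proof. by apply/val_inj; rewrite /= filter_id. Qed.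

Theorem theorem8p1 (k : fieldType) (k_char0 : [pchar k]%R =i pred0)
    (alpha beta : composition) :
  pi_Lambda (heis_Sigma (X k alpha) (X k beta)) =
  heis_Lambda (h k (partition_of alpha)) (h k (partition_of beta)).
Proof.
rewrite /pi_Lambda /heis_Sigma /heis_Lambda.
rewrite (bilinear_ext_base (@X_indep k)) (bilinear_ext_base (@h_indep k)).
have perm_part (a : composition) : perm_eq a (partition_of a).
  case: a => a /= a0; rewrite perm_sym perm_sort (@all_filterP _ _ a _) //.
  by apply/allP => y; apply: contraTneq => ->.
rewrite /heis_h -!(perm_sumn (perm_part _)).
(* The coordinates of the product in the [X a], on which the linear extension can be evaluated. *)
pose D := \sum_(maxn (sumn alpha) (sumn beta) <= n < (sumn alpha + sumn beta).+1)
  \sum_(M in heis_mx n alpha beta) << mx_comp M >> : {freeg composition / k}.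
have -> : heis_X k alpha beta = fglift (@X k) D.
  rewrite raddf_sum; apply: eq_bigr => n _; rewrite raddf_sum /=.
  by apply: eq_bigr => M _; rewrite liftU scale1r.
rewrite (linear_ext_fglift _ (@X_indep k)) raddf_sum; apply: eq_bigr => n _.
rewrite raddf_sum /= -(heis_sum_perm (h k) n (perm_part alpha) (perm_part beta)).
by apply: eq_bigr => M _; rewrite liftU scale1r partition_of_composition_of.
Qed.
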